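(* Let $\mathcal{H}$ be a complex Hilbert space and let $T\in\mathcal{B}(\mathcal{H})$ be a half-centered operator. Put $\mathcal{E}=\ker T^{*}$. The following are equivalent: (1) $T$ is centered. (2) $T^{*k}T^{k}\mathcal{E}\subseteq\mathcal{E}$ for all $k\in\mathbb{N}$.
   Context: A bounded operator $T$ is half-centered if the operators $T^{*k}T^{k}$, $k\geq 1$, mutually commute. It is centered if all the operators in the family $\{T^{k}T^{*k}:k\geq 1\}\cup\{T^{*k}T^{k}:k\geq 1\}$ mutually commute. $\mathbb{N}=\{0,1,2,\dots\}$. *)

(* Defs.v *)
From HB Require Import structures.
From mathcomp Require Import all_boot all_order all_algebra.
From mathcomp Require Import sesquilinear.
From mathcomp Require Import complex.
From mathcomp Require Import all_classical all_reals.
From mathcomp Require Import topology normedtype.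

Set Implicit Arguments.
Unset Strict Implicit.
Unset Printing Implicit Defensive.

Import Order.TTheory GRing.Theory Num.Theory.
Import numFieldNormedType.Exports.

Local Open Scope classical_set_scope.
Local Open Scope complex_scope.
Local Open Scope ring_scope.

(* The norm of a normed module over R[i] takes its values in R[i] (in the
   nonnegative reals).  The inner product is linear in its first argument and
   conjugate-linear in its second one. *)
HB.mixin Record CompleteNormedModule_isHilbert (R : realType) (H : Type)
    of CompleteNormedModule R[i] H := {
  inner : {dot H for (@Num.conj R[i])} ;
  inner_norm : forall x : H, inner x x = `|x| ^+ 2
}.

#[short(type="hilbertType")]
HB.structure Definition Hilbert (R : realType) :=
  {H of CompleteNormedModule R[i] H & CompleteNormedModule_isHilbert R H}.

Definition bounded_operator (R : realType) (H : hilbertType R)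
    (T : {linear H -> H}) : Prop :=
  bounded_near T (nbhs (0 : H)).

(* When T is bounded, the Riesz representation theorem yields, for every y, a
   z with <T x, y> = <x, z> for all x; it is unique because the inner product
   is definite.  The default value 0 is irrelevant in that case. *)
Definition adjoint (R : realType) (H : hilbertType R) (T : H -> H) (y : H) : H :=
  xget 0 [set z : H | forall x : H, inner (T x) y = inner x z].

Section HalfCentered.
Variables (R : realType) (H : hilbertType R).
Implicit Types (T : H -> H) (F : set (H -> H)) (k : nat).

Definition mutually_commute F : Prop :=
  forall A B, F A -> F B -> A \o B = B \o A.

Definition adjpow_pow T k : H -> H := iter k (adjoint T) \o iter k T.

Definition pow_adjpow T k : H -> H := iter k T \o iter k (adjoint T).

Definition half_centered T : Prop :=
  mutually_commute [set adjpow_pow T k | k in [set k | (1 <= k)%N]].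

Definition centered T : Prop :=
  mutually_commute ([set pow_adjpow T k | k in [set k | (1 <= k)%N]] `|`
                    [set adjpow_pow T k | k in [set k | (1 <= k)%N]]).

Definition adjoint_ker T : set H := [set x | adjoint T x = 0].

End HalfCentered.

(* Main.v *)
Require Import Defs.
From mathcomp Require Import all_boot all_order all_algebra.
From mathcomp Require Import sesquilinear complex ring lra.
From mathcomp Require Import all_classical all_reals.
From mathcomp Require Import topology normedtype.

Import Order.TTheory GRing.Theory Num.Theory.
Import numFieldNormedType.Exports.

Local Open Scope classical_set_scope.
Local Open Scope complex_scope.
Local Open Scope ring_scope.

(** Let A_k = T*^k T^k and B_k = T^k T*^k.

    If T is centered, then A_k commutes with B_1 = T T*, so for e in ker T* we
    get T T* A_k e = A_k T T* e = 0, and T T* v = 0 forces T* v = 0.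

    For the converse, note that a vector of ker T* orthogonal to ker T* is
    zero.  Hence two vectors agree as soon as they have the same image under T* and the same inner products with
    ker T* ([eq_modulo_adjoint_ker]).  When ker T* is stable under the
    self-adjoint A_k, both T v and A_k T v are orthogonal to ker T*, and this
    criterion gives in turn
    - T A_{k+1} = A_k T A_1, since T* sends both sides to A_1 A_{k+1}, up to
      the order of the factors, which commute;
    - by taking adjoints, A_{k+1} T* = A_1 T* A_k;
    - A_k B_j = B_j A_k by induction on j, because B_{j+1} = T B_j T* and the
      images under T* are A_{k+1} B_j T* and A_1 B_j T* A_k, which agree by
      the induction hypothesis and the previous identity;
    - B_i B_j = B_j B_i by induction, because
      B_{i+1} B_{j+1} = T B_i A_1 B_j T* and A_1 commutes with B_i and B_j.

    All of this rests on the identity <T x, y> = <x, T* y>, that is, on the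
    existence of the adjoint of a bounded operator ([adjointP]).  It comes from
    the Riesz representation theorem, proved by minimising the functional
    |z|^2 - 2 f(z).  Since infima only make sense for real values, that part
    is carried out in the underlying real Hilbert space, with inner product
    Re <x, y>; the complex identity for all x follows from the real one at x
    and at i x. *)

(** * The inner product and its real part *)

Section Inner.
Context {R : realType} {H : hilbertType R}.
Implicit Types (x y z : H) (t : R).

Lemma innerC x y : inner x y = (inner y x)^*%C.
Proof. by rewrite hermC expr0 mul1r. Qed.

Lemma innerBl x y z : inner (x - y) z = inner x z - inner y z.
Proof. exact: linearBl. Qed.

Lemma innerBr x y z : inner x (y - z) = inner x y - inner x z.
Proof. exact: linearBr. Qed.

Lemma inner_eq0 x : inner x x = 0 -> x = 0.
Proof. by move/eqP; rewrite dnorm_eq0 => /eqP. Qed.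

Lemma inner_injr x y : (forall z, inner z x = inner z y) -> x = y.
Proof.
move=> xy; apply/eqP; rewrite -subr_eq0; apply/eqP/inner_eq0.
by rewrite innerBr xy subrr.
Qed.

Definition rdot x y : R := complex.Re (inner x y).

Lemma rdotC x y : rdot x y = rdot y x.
Proof. by rewrite /rdot innerC; case: (inner y x). Qed.

Lemma rdotDl x y z : rdot (x + y) z = rdot x z + rdot y z.
Proof. by rewrite /rdot linearDl raddfD. Qed.

Lemma rdotZl t x y : rdot (t%:C *: x) y = t * rdot x y.
Proof.
rewrite /rdot linearZl_LR /=; case: (inner x y) => a b /=; ring.
Qed.

Lemma rdotDr x y z : rdot x (y + z) = rdot x y + rdot x z.
Proof. by rewrite rdotC rdotDl !(rdotC x). Qed.

Lemma rdotZr t x y : rdot x (t%:C *: y) = t * rdot x y.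
Proof. by rewrite rdotC rdotZl rdotC. Qed.

Lemma rdotNl x y : rdot (- x) y = - rdot x y.
Proof. by rewrite /rdot linearNl raddfN. Qed.

Lemma rdotNr x y : rdot x (- y) = - rdot x y.
Proof. by rewrite rdotC rdotNl rdotC. Qed.

Lemma sqr_norm_rdot x : `|x| ^+ 2 = (rdot x x)%:C.
Proof.
rewrite -inner_norm /rdot.
have : 0 <= inner x x by exact: dnorm_ge0.
by case: (inner x x) => a b; rewrite lecE /= => /andP[/eqP-> _].
Qed.

Lemma rdot_ge0 x : 0 <= rdot x x.
Proof. by rewrite -(@lecR R) -sqr_norm_rdot exprn_ge0. Qed.

Lemma norm_lt_rdot x t : 0 < t -> rdot x x < t ^+ 2 -> `|x| < t%:C.
Proof.
move=> t0 xt; rewrite -(@ltr_pXn2r _ 2) ?nnegrE ?normr_ge0 ?lecR ?ltW//.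
by rewrite sqr_norm_rdot -rmorphXn/= ltcR.
Qed.

Lemma rdot_lt_norm x t : 0 < t -> `|x| < t%:C -> rdot x x < t ^+ 2.
Proof.
move=> t0 xt; rewrite -(@ltcR R) -sqr_norm_rdot rmorphXn/=.
by rewrite ltr_pXn2r// ?nnegrE ?normr_ge0 ?lecR ?ltW.
Qed.

End Inner.

(** For N > 0, the quadratic polynomial e + 2 c t + N t^2 is tested at its
    minimiser t = - c / N.  Both the Cauchy-Schwarz inequality and the estimate on
    approximate minimisers below are instances. *)
Lemma discriminant_le (R : realFieldType) (e c N : R) :
  0 <= N -> (forall t, 0 <= e + 2 * t * c + t ^+ 2 * N) -> c ^+ 2 <= e * N.
Proof.
rewrite le_eqVlt => /predU1P[<- h|N0 h].
  have [->|c0] := eqVneq c 0; first by rewrite expr0n mulr0.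
  (* An affine function with a nonzero slope takes the value -1. *)
  suff : 0 <= (-1 : R) by lra.
  have := h (- (e + 1) / (2 * c)); congr (_ <= _); field; exact: c0.
have := h (- c / N).
rewrite -(pmulr_rge0 _ N0).
have -> : N * (e + 2 * (- c / N) * c + (- c / N) ^+ 2 * N) = e * N - c ^+ 2.
  by field; rewrite gt_eqF.
by rewrite subr_ge0.
Qed.

(** * The Riesz representation theorem *)

Section Riesz.
Context {R : realType} {H : hilbertType R}.
Implicit Types (x y z : H) (t : R).

Lemma rdot_CauchySchwarz x y : rdot x y ^+ 2 <= rdot y y * rdot x x.
Proof.
apply: discriminant_le => [|t]; first exact: rdot_ge0.
have := rdot_ge0 (t%:C *: x + y).
rewrite !(rdotDl, rdotDr, rdotZl, rdotZr) (rdotC y x).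
congr (_ <= _); ring.
Qed.

Context (f : H -> R) (M : R).
Hypothesis fD : {morph f : x y / x + y}.
Hypothesis fZ : forall t x, f (t%:C *: x) = t * f x.
Hypothesis f_bounded : forall x, f x ^+ 2 <= M * rdot x x.

(** If f = rdot z0, then Q z = |z - z0|^2 - |z0|^2, so the representing vector
    is the only possible minimiser. *)
Let Q z := rdot z z - 2 * f z.
Let m := inf (range Q).

Let Q_lbound : has_lbound (range Q).
Proof.
(* 2 f <= 2 sqrt (|M| N) <= |M| + N, where N is the squared norm. *)
exists (- `|M|) => _ [z _ <-]; rewrite /Q.
have := rdot_ge0 z; have := f_bounded z.
have := ler_norm M; have := normr_ge0 M.
move: (rdot z z) (f z) `|M| => N c M' M'0 MM' h N0.
rewrite leNgt; apply/negP => cN.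
have : (N + M') ^+ 2 < (2 * c) ^+ 2 by rewrite ltr_pXn2r// ?nnegrE; lra.
have : c ^+ 2 <= M' * N by apply: le_trans h _; rewrite ler_wpM2r.
have := sqr_ge0 (N - M'); nra.
Qed.

Let Q_ge z : m <= Q z.
Proof. by apply: (ge_inf Q_lbound); exists z. Qed.

Let near_min (e : R) : 0 < e -> exists z, Q z < m + e.
Proof.
move=> e0; have [|_ [z _ <-] ze] := @inf_adherent _ (range Q) _ e0.
  by split; [exists (Q 0), 0|exact: Q_lbound].
by exists z.
Qed.

(** The parallelogram identity gives
    Q a + Q b - 2 Q ((a + b) / 2) = |a - b|^2 / 2, while Q ((a + b) / 2) is at
    least the infimum; so minimising sequences are Cauchy. *)
Lemma near_min_close (a b : H) (d : R) :
  Q a < m + d -> Q b < m + d -> rdot (a - b) (a - b) <= 4 * d.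
Proof.
move=> ad bd; have := Q_ge (2^-1%:C *: (a + b)); move: ad bd; rewrite /Q.
rewrite !(rdotDl, rdotDr, rdotZl, rdotZr, rdotNl, rdotNr, fD, fZ) (rdotC b a).
lra.
Qed.

(** Approximate form of the Euler-Lagrange equation: Q (a + t x) cannot go
    below Q a by more than d, for any t.  Having it for approximate minimisers
    spares the continuity of Q in the limit. *)
Lemma near_min_represents (x a : H) (d : R) : Q a < m + d ->
  (rdot x a - f x) ^+ 2 <= d * rdot x x.
Proof.
move=> ad; apply: discriminant_le => [|t]; first exact: rdot_ge0.
have := Q_ge (t%:C *: x + a); move: ad; rewrite /Q.
rewrite !(rdotDl, rdotDr, rdotZl, rdotZr, fD, fZ) (rdotC a x).
nra.
Qed.

Theorem riesz_real : exists z, forall x, f x = rdot x z.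
Proof.
(* The near-minimisers, up to d, generate a Cauchy filter as d tends to 0. *)
pose F := filter_from [set d : R | 0 < d] (fun d => [set z | Q z < m + d]).
have FF : ProperFilter F.
  apply: filter_from_proper => [|d d0]; last exact: near_min.
  apply: filter_from_filter => [|d1 d2 /= d10 d20]; first by exists 1 => /=.
  exists (Num.min d1 d2) => /=; first by rewrite lt_min d10.
  move=> z /=; rewrite -ltrBlDl lt_min !ltrBlDl.
  by move=> /andP[].
have /cauchy_cvg/cvg_ex[z Fz] : cauchy F.
  apply/cauchyP => eps eps0.
  have [e e0 ->] : exists2 e : R, 0 < e & eps = e%:C.
    move: eps0; case: eps => a b; rewrite ltcE/= => /andP[/eqP-> a0].
    by exists a.
  have d0 : 0 < e ^+ 2 / 8 by rewrite divr_gt0// exprn_gt0.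
  have [a Qa] := near_min _ d0; exists a; exists (e ^+ 2 / 8) => //= b Qb.
  rewrite -ball_normE /=; apply: norm_lt_rdot => //.
  apply: le_lt_trans (near_min_close _ _ _ Qa Qb) _.
  have := exprn_gt0 2 e0; lra.
exists z => x; apply/esym/eqP; rewrite -subr_eq0 -sqrf_eq0 eq_le sqr_ge0 andbT.
apply/ler_addgt0Pl => e e0; rewrite addr0.
(* With this d, both (x, y) - f x and (x, z - y) have squares at most e / 4
   for a near-minimiser y close to the limit z; the + 1 avoids a division by
   zero when x = 0. *)
pose d := e / (4 * (rdot x x + 1)).
have Nx := rdot_ge0 x.
have d0 : 0 < d by rewrite divr_gt0// mulr_gt0//; lra.
have dx : 4 * (d * rdot x x) <= e.
  rewrite /d; have -> : 4 * (e / (4 * (rdot x x + 1)) * rdot x x) =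
    e * (rdot x x / (rdot x x + 1)) by field; lra.
  by rewrite ler_piMr ?(ltW e0)// ler_pdivrMr; lra.
have sd0 : 0 < Num.sqrt d by rewrite sqrtr_gt0.
have [y [zy Qy]] : exists y, ball z (Num.sqrt d)%:C y /\ Q y < m + d.
  have Fd : F [set y | Q y < m + d] by exists d.
  have Fb : F (ball z (Num.sqrt d)%:C).
    by apply: Fz; apply: nbhsx_ballx; rewrite ltcR.
  by have /(@filter_ex _ _ FF)[y []] := @filterI _ _ FF _ _ Fb Fd; exists y.
move: zy; rewrite -ball_normE /= => /(rdot_lt_norm _ _ sd0).
rewrite sqr_sqrtr ?(ltW d0)// => zy.
have h1 := near_min_represents x _ _ Qy.
have h2 := rdot_CauchySchwarz x (z - y).
have h3 : rdot x (z - y) ^+ 2 <= d * rdot x x.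
  by apply: le_trans h2 _; rewrite ler_wpM2r ?Nx ?(ltW zy).
move: h1 h3; rewrite rdotDr rdotNr.
move: (rdot x z) (rdot x y) (f x) => p q r h1 h3.
have : (p - r) ^+ 2 <= 2 * (q - r) ^+ 2 + 2 * (p - q) ^+ 2.
  by have := sqr_ge0 (p - q - (q - r)); nra.
lra.
Qed.

End Riesz.

(** * Adjoints of bounded operators *)

(** The functional to represent is x |-> <T x, y>. *)
Lemma adjointP {R : realType} {H : hilbertType R} (T : {linear H -> H}) :
  bounded_operator T ->
  forall x y : H, inner (T x) y = inner x (adjoint T y).
Proof.
move=> T_bounded x y.
have [r Tr] : exists r : R,
    forall x : H, rdot (T x) (T x) <= r ^+ 2 * rdot x x.
  have /linear_boundedP[M [Mreal TM]] := T_bounded.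
  have cM : M < (`|complex.Re M| + 1)%:C.
    move: Mreal; rewrite realE; case: M {TM} => a b; rewrite !lecE /=.
    move=> b0; have {b0} -> : b = 0 by case/orP: b0 => /andP[/eqP].
    by rewrite ltcE /= eqxx/= (le_lt_trans (ler_norm a))// ltrDl.
  exists (`|complex.Re M| + 1) => z.
  rewrite -(@lecR R) rmorphM rmorphXn /= -!sqr_norm_rdot -exprMn.
  by rewrite ler_pXn2r// ?nnegrE ?mulr_ge0 ?lecR ?addr_ge0// TM.
have [z Tz] : exists z, forall x, rdot (T x) y = rdot x z.
  apply: (@riesz_real _ _ (fun x => rdot (T x) y) (r ^+ 2 * rdot y y)).
  - by move=> a b; rewrite linearD rdotDl.
  - by move=> t a; rewrite linearZ rdotZl.
  move=> a; apply: le_trans (rdot_CauchySchwarz _ _) _.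
  by rewrite mulrAC mulrC ler_wpM2r ?rdot_ge0.
have : exists z : H, forall x : H, inner (T x) y = inner x z.
  (* The imaginary part of a complex number c is - Re (i c). *)
  exists z => a; have := Tz a; have := Tz ('i *: a).
  rewrite linearZ /rdot !linearZl_LR /=.
  case: (inner _ _) => a1 b1; case: (inner _ _) => a2 b2 /=.
  by simpc => /= ? ->; congr (_ +i* _); lra.
by move=> /(xgetPex (0 : H))/(_ x).
Qed.

(** * Commutation relations *)

Section Commutation.
Context {R : realType} {H : hilbertType R} (T : {linear H -> H}).
Hypothesis T_bounded : bounded_operator T.
Implicit Types (x y e : H) (i j k : nat).

Local Notation S := (adjoint T).
Local Notation A := (adjpow_pow T).
Local Notation B := (pow_adjpow T).

Let adj := adjointP T T_bounded.

Lemma inner_adjointl x y : inner (S x) y = inner x (T y).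
Proof. by rewrite innerC -adj -innerC. Qed.

Lemma adjointB x y : S (x - y) = S x - S y.
Proof. by apply: inner_injr => z; rewrite innerBr -!adj innerBr. Qed.

Lemma adjoint0 : S 0 = 0.
Proof. by have := adjointB 0 0; rewrite !subrr. Qed.

Lemma inner_iter k x y : inner (iter k T x) y = inner x (iter k S y).
Proof. by elim: k x y => //= k IH x y; rewrite adj IH -iterSr. Qed.

Lemma adjpow_pow_self_adjoint k x y : inner (A k x) y = inner x (A k y).
Proof. by rewrite /adjpow_pow /= innerC -inner_iter -innerC inner_iter. Qed.

Lemma adjpow_powS k x : A k.+1 x = S (A k (T x)).
Proof. by rewrite /adjpow_pow /= -iterSr. Qed.

Lemma pow_adjpowS k x : B k.+1 x = T (B k (S x)).
Proof. by rewrite /pow_adjpow /= -iterSr. Qed.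

Lemma adjpow_pow0 k : A k 0 = 0.
Proof.
rewrite /adjpow_pow /=.
have -> : iter k T 0 = 0 by elim: k => //= k ->; exact: linear0.
by elim: k => //= k ->; exact: adjoint0.
Qed.

(** The difference of x and y lies in ker T* and is orthogonal to ker T*, hence
    to itself. *)
Lemma eq_modulo_adjoint_ker x y : S x = S y ->
  (forall e, S e = 0 -> inner x e = inner y e) -> x = y.
Proof.
move=> Sxy xy; apply/eqP; rewrite -subr_eq0; apply/eqP/inner_eq0.
by rewrite innerBl xy ?subrr// adjointB Sxy subrr.
Qed.

Lemma inner_range_adjoint_ker x e : S e = 0 -> inner (T x) e = 0.
Proof. by rewrite adj => ->; exact: linear0r. Qed.

(** |T* A_k e|^2 = <T T* A_k e, A_k e> = <A_k T T* e, A_k e> = 0. *)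
Lemma adjoint_ker_stable (AB1 : forall k x, A k (B 1 x) = B 1 (A k x)) k e :
  S e = 0 -> S (A k e) = 0.
Proof.
move=> Se; apply: inner_eq0; rewrite inner_adjointl -[T (S _)]/(B 1 (A k e)).
by rewrite -AB1 /pow_adjpow /= Se linear0 adjpow_pow0; exact: linear0r.
Qed.

Hypothesis AC : forall i j x, A i (A j x) = A j (A i x).
Hypothesis AE : forall k e, S e = 0 -> S (A k e) = 0.

Lemma T_adjpow_pow k x : T (A k.+1 x) = A k (T (A 1 x)).
Proof.
apply: eq_modulo_adjoint_ker => [|e Se].
  by rewrite -adjpow_powS -[LHS]/(A 1 (A k.+1 x)) AC.
by rewrite adjpow_pow_self_adjoint !inner_range_adjoint_ker// AE.
Qed.

(** The adjoint of the identity [T_adjpow_pow]. *)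
Lemma adjpow_pow_adjoint k x : A k.+1 (S x) = A 1 (S (A k x)).
Proof.
apply: inner_injr => w; rewrite -adjpow_pow_self_adjoint -adj T_adjpow_pow.
by rewrite adjpow_pow_self_adjoint adj -adjpow_pow_self_adjoint.
Qed.

Lemma adjpow_pow_pow_adjpowC k j x : A k (B j x) = B j (A k x).
Proof.
elim: j k x => // j IH k x; rewrite !pow_adjpowS.
apply: eq_modulo_adjoint_ker => [|e Se].
  (* On the right, T* T is A_1, which goes through B_j by induction. *)
  by rewrite -adjpow_powS IH adjpow_pow_adjoint -IH.
by rewrite adjpow_pow_self_adjoint !inner_range_adjoint_ker// AE.
Qed.

Lemma pow_adjpowC i j x : B i (B j x) = B j (B i x).
Proof.
elim: i j x => [|i IH] [|j] x //; rewrite !pow_adjpowS.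
by rewrite -![S (T _)]/(A 1 _) !adjpow_pow_pow_adjpowC IH.
Qed.

End Commutation.

Theorem proposition2p1 (R : realType) (H : hilbertType R) (T : {linear H -> H})
    (T_bounded : bounded_operator T) (T_half_centered : half_centered T) :
  centered T <->
  (forall k : nat, adjpow_pow T k @` adjoint_ker T `<=` adjoint_ker T).
Proof.
split=> [cT k _ [x Sx <-]|AE].
  apply: (adjoint_ker_stable T T_bounded) Sx => -[//|{}k] y.
  have := cT (adjpow_pow T k.+1) (pow_adjpow T 1) (or_intror _) (or_introl _).
  by move=> /(_ _ _)/(congr1 (@^~ y)); apply; [exists k.+1|exists 1%N].
have AC i j x : adjpow_pow T i (adjpow_pow T j x) =
    adjpow_pow T j (adjpow_pow T i x).
  case: i j => [|i] [|j] //.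
  have := T_half_centered (adjpow_pow T i.+1) (adjpow_pow T j.+1).
  by move=> /(_ _ _)/(congr1 (@^~ x)); apply; [exists i.+1|exists j.+1].
have AK k e : adjoint T e = 0 -> adjoint T (adjpow_pow T k e) = 0.
  by move=> Se; apply: AE; exists e.
have AB := adjpow_pow_pow_adjpowC T T_bounded AC AK.
have BC := pow_adjpowC T T_bounded AC AK.
by move=> _ _ [] [i _ <-] [] [j _ <-]; apply/funext => x;
  [exact: BC | exact/esym/AB | exact: AB | exact: AC].
Qed.
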